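(* Let $p$ be a prime number, let $A$ be a commutative $\mathbb{F}_p$-algebra, and let $W = W_p(A)$ be its ring of $p$-typical Witt vectors, with Frobenius $F: W\to W$ and Verschiebung $V: W\to W$. Then the diagram $\mathcal{W} = (\Phi,\Psi,u,v)$ of abelian groups with $\Phi = \Psi = W$, $v = V:\Phi\to\Psi$ and $u = F:\Psi\to\Phi$ is an object of $\mathrm{Perv}(\mathbb{C},0)$ (that is, $1 - vu$ is invertible), and it is a ring object of $\mathrm{Perv}(\mathbb{C},0)$.
   Context: $\mathrm{Perv}(\mathbb{C},0)$ denotes the category of quadruples $(\Phi,\Psi,u,v)$ where $\Phi,\Psi$ are abelian groups and $v:\Phi\to\Psi$, $u:\Psi\to\Phi$ are homomorphisms such that $1-vu:\Psi\to\Psi$ is invertible (equivalently, $1-uv:\Phi\to\Phi$ is invertible). Morphisms are pairs of homomorphisms commuting with $u$ and $v$. ($\Phi$ plays the role of the space of vanishing cycles, and $\Psi$ that of nearby cycles.) An object $B = (B_0,B_1,u,v)$ of $\mathrm{Perv}(\mathbb{C},0)$, with $\Phi = B_0$, $\Psi = B_1$, $u: B_1\to B_0$, $v: B_0\to B_1$, is called a ring object if: (i) $B_0$ and $B_1$ are rings (whose additive groups are the given ones); (ii) $u$ is a ring homomorphism; (iii) the projection formula $v(u(y)x) = y\,v(x)$ holds for all $y\in B_1$, $x\in B_0$. *)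

(* Defs.v *)
From HB Require Import structures.
From mathcomp Require Import all_boot all_order all_algebra.
From mathcomp Require Import finmap monalg.
From mathcomp Require boolp.

Set Implicit Arguments.
Unset Strict Implicit.
Unset Printing Implicit Defensive.

Import GRing.Theory.
Local Open Scope ring_scope.

(* Congruence modulo the principal ideal generated by a natural number.       *)
Definition eqmodn (R : comPzRingType) (d : nat) (a b : R) : Prop :=
  exists c : R, a = b + d%:R * c.

Section Congruence.
Variable R : comPzRingType.
Implicit Types (d p : nat) (a b c : R).

Lemma eqmodn_refl d a : eqmodn d a a.
Proof. by exists 0; rewrite mulr0 addr0. Qed.

Lemma eqmodn_sym d a b : eqmodn d a b -> eqmodn d b a.
Proof. by case=> c ->; exists (- c); rewrite mulrN addrK. Qed.

Lemma eqmodn_trans d a b c : eqmodn d a b -> eqmodn d b c -> eqmodn d a c.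
Proof. by case=> x -> [y ->]; exists (y + x); rewrite mulrDr addrA. Qed.

Lemma eqmodnD d a b a' b' :
  eqmodn d a b -> eqmodn d a' b' -> eqmodn d (a + a') (b + b').
Proof. by case=> x -> [y ->]; exists (x + y); rewrite mulrDr addrACA. Qed.

Lemma eqmodnN d a b : eqmodn d a b -> eqmodn d (- a) (- b).
Proof. by case=> x ->; exists (- x); rewrite mulrN opprD. Qed.

Lemma eqmodnM d a b a' b' :
  eqmodn d a b -> eqmodn d a' b' -> eqmodn d (a * a') (b * b').
Proof.
case=> x -> [y ->]; exists (b * y + x * b' + x * (d%:R * y)).
rewrite mulrDl !mulrDr -!addrA; congr (_ + _).
by rewrite (mulrCA b) !mulrA.
Qed.

Lemma eqmodn_sum d (I : Type) (r : seq I) (P : pred I) (E F : I -> R) :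
  (forall i, P i -> eqmodn d (E i) (F i)) ->
  eqmodn d (\sum_(i <- r | P i) E i) (\sum_(i <- r | P i) F i).
Proof.
move=> EF; elim/big_rec2: _ => [|i x y Pi]; first exact: eqmodn_refl.
by apply: eqmodnD; apply: EF.
Qed.

Lemma eqmodn_sum0 d (I : Type) (r : seq I) (P : pred I) (E : I -> R) :
  (forall i, P i -> eqmodn d (E i) 0) ->
  eqmodn d (\sum_(i <- r | P i) E i) 0.
Proof.
move=> E0; elim/big_ind: _ => //; first exact: eqmodn_refl.
by move=> x y x0 y0; rewrite -[X in eqmodn d _ X]addr0; apply: eqmodnD.
Qed.

Lemma eqmodn_scale d e a b :
  eqmodn d a b -> eqmodn (e * d) (e%:R * a) (e%:R * b).
Proof. by case=> c ->; exists c; rewrite mulrDr natrM mulrA. Qed.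

Lemma eqmodn_dvd d e a b : (d %| e)%N -> eqmodn e a b -> eqmodn d a b.
Proof.
case/dvdnP=> k -> [c ->]; exists (k%:R * c).
by rewrite mulrA -natrM mulnC.
Qed.

Lemma eqmodn0 d c : eqmodn d (d%:R * c) 0.
Proof. by exists c; rewrite add0r. Qed.

Lemma eqmodn_exprD p a b :
  prime p -> eqmodn p ((a + b) ^+ p) (a ^+ p + b ^+ p).
Proof.
case: p => [|p] // p_pr; rewrite exprDn big_ord_recl big_ord_recr /=.
rewrite subn0 expr0 mulr1 bin0 mulr1n subnn expr0 mul1r binn mulr1n.
apply: eqmodnD; first exact: eqmodn_refl.
rewrite -[X in eqmodn _ _ X]add0r; apply: eqmodnD; last exact: eqmodn_refl.
apply: eqmodn_sum0 => i _; rewrite -mulr_natl.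
have /dvdnP[k ->] : (p.+1 %| 'C(p.+1, lift ord0 (widen_ord (leqnSn p) i)))%N.
  by apply: prime_dvd_bin; rewrite // lift0 /= !ltnS ltn_ord.
by rewrite mulnC natrM -mulrA; apply: eqmodn0.
Qed.

Lemma eqmodn_expr_sum p (I : Type) (r : seq I) (E : I -> R) : prime p ->
  eqmodn p ((\sum_(i <- r) E i) ^+ p) (\sum_(i <- r) E i ^+ p).
Proof.
move=> p_pr; elim: r => [|i r IHr].
  by rewrite !big_nil expr0n eqn0Ngt prime_gt0 //; apply: eqmodn_refl.
rewrite !big_cons; apply: eqmodn_trans (eqmodn_exprD _ _ p_pr) _.
by apply: eqmodnD => //; apply: eqmodn_refl.
Qed.

Lemma eqmodn_int p (z : int) : prime p ->
  eqmodn p (z%:~R ^+ p) (z%:~R : R).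
Proof.
move=> p_pr.
have natF (n : nat) : eqmodn p (n%:R ^+ p) (n%:R : R).
  elim: n => [|n IHn].
    by rewrite expr0n eqn0Ngt prime_gt0 //; apply: eqmodn_refl.
  rewrite -addn1 natrD; apply: eqmodn_trans (eqmodn_exprD _ _ p_pr) _.
  by apply: eqmodnD => //; rewrite expr1n; apply: eqmodn_refl.
case: z => n; first by rewrite -pmulrn; apply: natF.
rewrite NegzE rmorphN /= -pmulrn.
have /eqmodnN := natF n.+1; apply: eqmodn_trans.
have := eqmodn_exprD n.+1%:R (- n.+1%:R) p_pr.
rewrite subrr expr0n eqn0Ngt prime_gt0 //= => /eqmodn_sym.
move=> /(eqmodnD (eqmodn_refl p (- n.+1%:R ^+ p))).
by rewrite addr0 addKr.
Qed.

Lemma eqmodn_exprp p k a b : prime p ->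
  eqmodn (p ^ k.+1) a b -> eqmodn (p ^ k.+2) (a ^+ p) (b ^+ p).
Proof.
case: p => [|[|p]] // _ [c ->]; set d := (p.+2 ^ k.+1)%N.
rewrite exprDn big_ord_recl big_ord_recl /= subn0 expr0 mulr1 bin0 mulr1n.
rewrite -[X in eqmodn _ _ X]addr0.
apply: eqmodnD; first exact: eqmodn_refl.
rewrite -[X in eqmodn _ _ X]addr0; apply: eqmodnD.
  rewrite expr1 bin1 subn1 /= -mulr_natl mulrCA [X in b ^+ _ * X]mulrA -natrM.
  rewrite -[(p.+2 * d)%N]expnS mulrCA.
  exact: eqmodn0.
apply: eqmodn_sum0 => i _; rewrite -mulrnAr mulrC.
rewrite exprMn -natrX -mulrnAr -mulrA.
have /dvdnP[e ->] : (p.+2 ^ k.+2 %| d ^ bump 0 (bump 0 i))%N.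
  rewrite /bump /= !add1n -expnM dvdn_exp2l // mulnS mulnS addnA.
  by apply: leq_trans (leq_addr _ _); rewrite addSn addnS !ltnS leq_addl.
by rewrite mulnC natrM -mulrA; apply: eqmodn0.
Qed.

Lemma eqmodn_exprpn p k a b : prime p ->
  eqmodn p a b -> eqmodn (p ^ k.+1) (a ^+ (p ^ k)) (b ^+ (p ^ k)).
Proof.
move=> p_pr ab; elim: k => [|k IHk]; first by rewrite expn1 !expr1.
by rewrite [(p ^ k.+1)%N in X in eqmodn _ X]expnSr [(p ^ k.+1)%N in X in
   eqmodn _ _ X]expnSr !exprM; apply: eqmodn_exprp.
Qed.

End Congruence.

(* Polynomials with integer coefficients in the commuting variables indexed   *)
(* by an arbitrary set.                                                       *)
Notation intpoly V := {malg int[{cmonom V}]}.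

Section IntPoly.
Variable V : choiceType.
Implicit Types (f g : intpoly V) (m : {cmonom V}).

Definition ivar (i : V) : intpoly V := << ucm i >>.

(* Coefficientwise quotient, only used below when the division is exact.      *)
Definition divpoly (d : nat) f : intpoly V :=
  [malg m in msupp f => (f@_m %/ d%:Z)%Z].

Section Eval.
Variables (A : comPzRingType) (v : V -> A).

Definition meval m : A := \prod_(i <- finsupp m) v i ^+ m i.

(* The library evaluation mmap excludes trivial target rings.                 *)
Definition peval f : A := \sum_(m <- msupp f) (f@_m)%:~R * meval m.

End Eval.
End IntPoly.

Section IntPolyTheory.
Variable V : choiceType.
Implicit Types (f g : intpoly V) (m : {cmonom V}).

Lemma mevalEw (A : comPzRingType) (v : V -> A) m (d : {fset V}) :
  (finsupp m `<=` d)%fset -> meval v m = \prod_(i <- d) v i ^+ m i.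
Proof.
move=> le; rewrite /meval (big_fset_incl _ le) //= => i _.
by rewrite -cmE_neq0 negbK => /eqP ->; rewrite expr0.
Qed.

Lemma meval1 (A : comPzRingType) (v : V -> A) : meval v mone = 1.
Proof. by rewrite /meval mdom1 big_seq_fset0. Qed.

Lemma mevalM (A : comPzRingType) (v : V -> A) m1 m2 :
  meval v (mmul m1 m2) = meval v m1 * meval v m2.
Proof.
rewrite {1}/meval mdomD.
rewrite [meval v m1](mevalEw v (fsubsetUl _ (finsupp m2))).
rewrite [meval v m2](mevalEw v (fsubsetUr (finsupp m1) _)).
by rewrite -big_split; apply: eq_bigr => i _; rewrite cmM exprD.
Qed.

Lemma mevalU (A : comPzRingType) (v : V -> A) i : meval v (ucm i) = v i.
Proof. by rewrite /meval mdomU big_seq_fset1 cmUU. Qed.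

Lemma pevalEw (A : comPzRingType) (v : V -> A) f (d : {fset {cmonom V}}) :
  (msupp f `<=` d)%fset -> peval v f = \sum_(m <- d) (f@_m)%:~R * meval v m.
Proof.
move=> le; rewrite /peval (big_fset_incl _ le) //= => m _ /mcoeff_outdom ->.
by rewrite mul0r.
Qed.

Lemma pevalU (A : comPzRingType) (v : V -> A) c m :
  peval v << c *g m >> = c%:~R * meval v m.
Proof. by rewrite (pevalEw v msuppU_le) big_seq_fset1 mcoeffUU. Qed.

Lemma peval_is_zmod_morphism (A : comPzRingType) (v : V -> A) :
  zmod_morphism (peval v).
Proof.
move=> f g; pose d := (msupp f `|` msupp g `|` msupp (f - g))%fset.
have fd : (msupp f `<=` d)%fset by rewrite /d -fsetUA fsubsetUl.
have gd : (msupp g `<=` d)%fset by rewrite /d fsetUAC fsubsetUr.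
have hd : (msupp (f - g) `<=` d)%fset by rewrite /d fsubsetUr.
rewrite (pevalEw v fd) (pevalEw v gd) (pevalEw v hd) -sumrB.
by apply: eq_bigr => m _; rewrite mcoeffB rmorphB mulrBl.
Qed.

HB.instance Definition _ (A : comPzRingType) (v : V -> A) :=
  GRing.isZmodMorphism.Build (intpoly V) A (peval v)
    (peval_is_zmod_morphism v).

Lemma peval_is_monoid_morphism (A : comPzRingType) (v : V -> A) :
  monoid_morphism (peval v).
Proof.
split=> [|f g]; first by rewrite pevalU meval1 mulr1.
rewrite malgME raddf_sum mulr_suml /=; apply: eq_bigr => i _.
rewrite raddf_sum mulr_sumr /=; apply: eq_bigr => j _.
by rewrite pevalU rmorphM mevalM mulrACA.
Qed.

HB.instance Definition _ (A : comPzRingType) (v : V -> A) :=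
  GRing.isMonoidMorphism.Build (intpoly V) A (peval v)
    (peval_is_monoid_morphism v).

Lemma peval_var (A : comPzRingType) (v : V -> A) i : peval v (ivar i) = v i.
Proof. by rewrite pevalU mevalU mul1r. Qed.

Lemma rmorph_peval (A B : comPzRingType) (h : {rmorphism A -> B})
  (v : V -> A) f : h (peval v f) = peval (h \o v) f.
Proof.
rewrite rmorph_sum; apply: eq_bigr => m _.
rewrite rmorphM rmorph_int rmorph_prod; congr (_ * _).
by apply: eq_bigr => i _; rewrite rmorphXn.
Qed.

Lemma eq_peval (A : comPzRingType) (v w : V -> A) f :
  v =1 w -> peval v f = peval w f.
Proof.
move=> vw; apply: eq_bigr => m _; congr (_ * _).
by apply: eq_bigr => i _; rewrite vw.
Qed.

Local Notation mono m := (<< (1 : int) *g m >> : intpoly V).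

Fact mono_mul m1 m2 : mono m1 * mono m2 = mono (mmul m1 m2).
Proof. by rewrite malgM_def fgmulUU mulr1. Qed.

Fact mono_var_exp i n :
  exists2 k : {cmonom V}, ivar i ^+ n = mono k
    & forall j, k j = (n * (i == j))%N.
Proof.
elim: n => [|n [k kE kj]].
  by exists mone => [|j]; [rewrite expr0 | rewrite cm1 mul0n].
exists (mmul (ucm i) k) => [|j]; last by rewrite cmM cmU kj mulSn.
rewrite exprS kE; exact: mono_mul.
Qed.

Lemma meval_ivar m : meval (@ivar V) m = mono m.
Proof.
have prodE (s : seq V) : uniq s ->
    exists2 k : {cmonom V}, \prod_(i <- s) ivar i ^+ m i = mono k
      & forall j, k j = (if j \in s then m j else 0)%N.
  elim: s => [_|i s IHs] /=.
    by exists mone => [|j]; [rewrite big_nil | rewrite cm1].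
  case/andP=> i_s /IHs[k kE kj]; have [l lE lj] := mono_var_exp i (m i).
  exists (mmul l k) => [|j].
    rewrite big_cons kE lE; exact: mono_mul.
  rewrite cmM lj kj in_cons [j == i]eq_sym; have [<-|_] := eqVneq i j.
    by rewrite (negPf i_s) muln1 addn0.
  by rewrite muln0.
rewrite /meval; have [k -> kE] := prodE _ (fset_uniq (finsupp m)).
suff -> : k = m by exact: erefl.
apply/eqP/cmP => j; rewrite kE.
by case: ifP => // /negbT; rewrite -cmE_neq0 negbK => /eqP.
Qed.

Fact mono_int (c : int) m : c%:~R * mono m = << c *g m >>.
Proof. by rewrite mulrzl -raddfMz intz. Qed.

Lemma peval_id f : peval (@ivar V) f = f.
Proof.
rewrite [RHS]monalgE; apply: eq_bigr => m _; rewrite meval_ivar.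
exact: mono_int.
Qed.

Lemma divpolyK d f : (0 < d)%N -> divpoly d (d%:R * f) = f.
Proof.
move=> d_gt0; apply/malgP => m; rewrite /divpoly mcoeffE.
have dfE : (d%:R * f)@_m = d%:Z * f@_m.
  by rewrite mulr_natl mcoeffMn -mulr_natl natz.
have [|] := boolP (m \in msupp (d%:R * f)).
  by rewrite dfE mulKz // eqz_nat -lt0n.
move/mcoeff_outdom; rewrite dfE => /eqP.
by rewrite mulf_eq0 eqz_nat eqn0Ngt d_gt0 /= => /eqP ->.
Qed.

(* The lift of Frobenius raising every variable to the power p.               *)
Definition frobpoly (p : nat) : intpoly V -> intpoly V :=
  peval (fun i => ivar i ^+ p).

HB.instance Definition _ p := GRing.RMorphism.on (frobpoly p).

Lemma frobpolyE p f : prime p -> eqmodn p (frobpoly p f) (f ^+ p).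
Proof.
move=> p_pr; rewrite -{2}[f]peval_id; apply: eqmodn_sym.
apply: eqmodn_trans (eqmodn_expr_sum _ _ p_pr) _.
apply: eqmodn_sum => m _; rewrite exprMn; apply: eqmodnM.
  exact: eqmodn_int.
rewrite /meval -prodrXl; under eq_bigr do rewrite exprAC.
exact: eqmodn_refl.
Qed.

End IntPolyTheory.

Section Ghost.
Variable p : nat.

Definition ghost (A : comPzRingType) (x : nat -> A) (n : nat) : A :=
  \sum_(i < n.+1) (p ^ i)%:R * x i ^+ (p ^ (n - i)).

Section Unghost.
Variables (R : comPzRingType) (divR : nat -> R -> R).
Implicit Type f : nat -> R.

(* If divR performs exact division by positive integers in R, unghost f is    *)
(* the sequence s such that ghost s = f, provided there is one:               *)
(*   s n = (f n - \sum_(i < n) p ^ i * s i ^ (p ^ (n - i))) / p ^ n.          *)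
Fixpoint unghost_seq f (n : nat) : seq R :=
  if n is m.+1 then
    let s := unghost_seq f m in
    rcons s (divR (p ^ m)
      (f m - \sum_(i < m) (p ^ i)%:R * s`_i ^+ (p ^ (m - i))))
  else [::].

Definition unghost f (n : nat) : R := (unghost_seq f n.+1)`_n.

End Unghost.
End Ghost.

Section GhostTheory.
Variable p : nat.
Hypothesis p_pr : prime p.

Let ppos n : (0 < p ^ n)%N.
Proof. by rewrite expn_gt0 prime_gt0. Qed.

Lemma eq_ghost (A : comPzRingType) (x y : nat -> A) n :
  (forall i, i <= n -> x i = y i)%N -> ghost p x n = ghost p y n.
Proof. by move=> xy; apply: eq_bigr => i _; rewrite xy // -ltnS. Qed.

Lemma rmorph_ghost (A B : comPzRingType) (h : {rmorphism A -> B}) x n :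
  h (ghost p x n) = ghost p (h \o x) n.
Proof.
rewrite rmorph_sum; apply: eq_bigr => i _.
by rewrite rmorphM rmorph_nat rmorphXn.
Qed.

Lemma ghostS (A : comPzRingType) (x : nat -> A) n :
  ghost p x n =
  \sum_(i < n) (p ^ i)%:R * x i ^+ (p ^ (n - i)) + (p ^ n)%:R * x n.
Proof. by rewrite /ghost big_ord_recr /= subnn expn0 expr1. Qed.

Variables (R : comPzRingType) (divR : nat -> R -> R).
Hypothesis divRK : forall d a, (0 < d)%N -> divR d (d%:R * a) = a.
Variable phi : {rmorphism R -> R}.
Hypothesis phiE : forall a, eqmodn p (phi a) (a ^+ p).
Implicit Types (x y f g : nat -> R).

Lemma natmulI d : (0 < d)%N -> injective (fun a : R => d%:R * a).
Proof. by move=> d_gt0 a b /= ab; rewrite -(divRK a d_gt0) ab divRK. Qed.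

Lemma ghost_inj x y : ghost p x =1 ghost p y -> x =1 y.
Proof.
move=> gxy; elim/ltn_ind => n IHn.
have := gxy n; rewrite !ghostS.
under eq_bigr => i _ do rewrite (IHn i (ltn_ord i)).
by move/addrI/(natmulI (ppos n)).
Qed.

Lemma size_unghost_seq f n : size (unghost_seq p divR f n) = n.
Proof. by elim: n => //= n IHn; rewrite size_rcons IHn. Qed.

Lemma nth_unghost_seq f n i :
  (i < n)%N -> (unghost_seq p divR f n)`_i = unghost p divR f i.
Proof.
elim: n => // n IHn; rewrite ltnS leq_eqVlt => /orP[/eqP -> //|i_n].
by rewrite [LHS]nth_rcons size_unghost_seq i_n IHn.
Qed.

Lemma unghostE f n : unghost p divR f n = divR (p ^ n)
  (f n - \sum_(i < n) (p ^ i)%:R * unghost p divR f i ^+ (p ^ (n - i))).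
Proof.
rewrite {1}/unghost [unghost_seq p divR f n.+1]/=.
rewrite nth_rcons size_unghost_seq ltnn eqxx; congr (divR _ (_ - _)).
by apply: eq_bigr => i _; rewrite nth_unghost_seq.
Qed.

(* Dwork's lemma. *)
Definition dwork f : Prop :=
  forall n, eqmodn (p ^ n.+1) (f n.+1) (phi (f n)).

Lemma dwork_step x n : eqmodn (p ^ n.+1)
  (\sum_(i < n.+1) (p ^ i)%:R * x i ^+ (p ^ (n.+1 - i)))
  (phi (ghost p x n)).
Proof.
rewrite rmorph_ghost; apply: eqmodn_sum => i _ /=.
have le_in : (i <= n)%N by rewrite -ltnS.
rewrite subSn // [in X in eqmodn _ X]expnS exprM.
have -> : (p ^ n.+1 = p ^ i * p ^ (n - i).+1)%N.
  by rewrite -expnD addnS subnKC.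
apply/eqmodn_scale/eqmodn_exprpn => //.
exact/eqmodn_sym/phiE.
Qed.

Lemma dwork_ghost x : dwork (ghost p x).
Proof.
move=> n; rewrite ghostS -[X in eqmodn _ _ X]addr0.
by apply: eqmodnD (eqmodn0 _ _); apply: dwork_step.
Qed.

Lemma ghost_unghost f : dwork f -> ghost p (unghost p divR f) =1 f.
Proof.
move=> df; pose S n := \sum_(i < n) (p ^ i)%:R *
  unghost p divR f i ^+ (p ^ (n - i)).
have fE n c : f n = S n + (p ^ n)%:R * c -> ghost p (unghost p divR f) n = f n.
  move=> fnE; have cE : unghost p divR f n = c.
    by rewrite unghostE fnE addrAC subrr add0r divRK.
  by rewrite ghostS cE -fnE.
elim=> [|n IHn].
  by apply: (fE _ (f 0%N)); rewrite /S big_ord0 add0r mul1r.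
suff [c] : eqmodn (p ^ n.+1) (f n.+1) (S n.+1) by apply: fE.
apply: eqmodn_trans (df n) (eqmodn_sym _).
by rewrite -IHn; apply: dwork_step.
Qed.

Lemma dworkD f g : dwork f -> dwork g -> dwork (fun n => f n + g n).
Proof. by move=> df dg n; rewrite rmorphD; apply: eqmodnD. Qed.

Lemma dworkM f g : dwork f -> dwork g -> dwork (fun n => f n * g n).
Proof. by move=> df dg n; rewrite rmorphM; apply: eqmodnM. Qed.

Lemma dworkN f : dwork f -> dwork (fun n => - f n).
Proof. by move=> df n; rewrite rmorphN; apply: eqmodnN. Qed.

Lemma dwork_shift f : dwork f -> dwork (fun n => f n.+1).
Proof. by move=> df n; apply: eqmodn_dvd (df n.+1); apply: dvdn_exp2l. Qed.

End GhostTheory.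

(* The p-typical Witt vectors (a_0, a_1, a_2, ...) over A.                    *)
Record witt (p : nat) (p_pr : prime p) (A : Type) : Type :=
  Witt { wcoef : nat -> A }.

HB.instance Definition _ p (p_pr : prime p) A :=
  boolp.gen_eqMixin (witt p_pr A).
HB.instance Definition _ p (p_pr : prime p) A :=
  boolp.gen_choiceMixin (witt p_pr A).

(* The universal polynomials of Witt vector addition, multiplication and      *)
(* opposite: the integer polynomials whose ghost components are the sum, the  *)
(* product and the opposite of those of (X_n)_n and (Y_n)_n, where X_n and    *)
(* Y_n are the variables indexed by (false, n) and (true, n). They are locked *)
(* because comparing two of them by conversion does not terminate in practice.*)
Definition ghostX (p : nat) : nat -> intpoly (bool * nat)%type :=
  ghost p (fun i => ivar (false, i)).
Definition ghostY (p : nat) : nat -> intpoly (bool * nat)%type :=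
  ghost p (fun i => ivar (true, i)).

HB.lock Definition wittD_poly (p : nat) : nat -> intpoly (bool * nat)%type :=
  unghost p (@divpoly _) (fun n => ghostX p n + ghostY p n).
HB.lock Definition wittM_poly (p : nat) : nat -> intpoly (bool * nat)%type :=
  unghost p (@divpoly _) (fun n => ghostX p n * ghostY p n).
HB.lock Definition wittN_poly (p : nat) : nat -> intpoly (bool * nat)%type :=
  unghost p (@divpoly _) (fun n => - ghostX p n).

(* The universal polynomials of the Witt vector Frobenius: their ghost        *)
(* components are those of (X_n)_n shifted by one.                            *)
HB.lock Definition wittF_poly (p : nat) : nat -> intpoly (bool * nat)%type :=
  unghost p (@divpoly _) (fun n => ghostX p n.+1).

Section WittOperations.
Variables (p : nat) (p_pr : prime p).

Section Operations.
Variable A : comPzRingType.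
Implicit Types x y : witt p_pr A.

Definition wittXY x y (i : bool * nat) : A := wcoef (if i.1 then y else x) i.2.

Definition witt0 : witt p_pr A := Witt p_pr (fun=> 0).
Definition witt1 : witt p_pr A := Witt p_pr (fun n => (n == 0)%:R).
Definition wittD x y : witt p_pr A :=
  Witt p_pr (fun n => peval (wittXY x y) (wittD_poly p n)).
Definition wittM x y : witt p_pr A :=
  Witt p_pr (fun n => peval (wittXY x y) (wittM_poly p n)).
(* The polynomials of opposite and Frobenius involve only the X_n.            *)
Definition wittN x : witt p_pr A :=
  Witt p_pr (fun n => peval (wittXY x x) (wittN_poly p n)).

Definition wittF x : witt p_pr A :=
  Witt p_pr (fun n => peval (wittXY x x) (wittF_poly p n)).
Definition wittV x : witt p_pr A :=
  Witt p_pr (fun n => if n is m.+1 then wcoef x m else 0).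

End Operations.

Definition witt_map (A B : Type) (h : A -> B) (x : witt p_pr A) : witt p_pr B :=
  Witt p_pr (h \o wcoef x).

End WittOperations.

Section WittTheory.
Variables (p : nat) (p_pr : prime p).

Local Notation W A := (witt p_pr A).
Local Notation gh x := (ghost p (wcoef x)).

Lemma wittP (A : Type) (x y : W A) : wcoef x =1 wcoef y -> x = y.
Proof. by case: x y => [x] [y] /= /boolp.funext ->. Qed.

Lemma peval_ghostX (A : comPzRingType) (x y : W A) n :
  peval (wittXY x y) (ghostX p n) = gh x n.
Proof.
by rewrite rmorph_ghost; apply: eq_ghost => i _; rewrite /= peval_var.
Qed.

Lemma peval_ghostY (A : comPzRingType) (x y : W A) n :
  peval (wittXY x y) (ghostY p n) = gh y n.
Proof.
by rewrite rmorph_ghost; apply: eq_ghost => i _; rewrite /= peval_var.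
Qed.

Let frob : {rmorphism intpoly (bool * nat)%type ->
                      intpoly (bool * nat)%type} := frobpoly p.

Let frobE f : eqmodn p (frob f) (f ^+ p).
Proof. exact: frobpolyE. Qed.

Fact ghost_peval (A : comPzRingType) (v : bool * nat -> A) G n :
  dwork p frob G ->
  ghost p (fun n => peval v (unghost p (@divpoly _) G n)) n = peval v (G n).
Proof.
move=> dG; rewrite -[in RHS](ghost_unghost p_pr (@divpolyK _) frobE dG n).
by rewrite rmorph_ghost.
Qed.

Fact dwork_ghostX : dwork p frob (ghostX p).
Proof. exact: (dwork_ghost p_pr frobE). Qed.

Fact dwork_ghostY : dwork p frob (ghostY p).
Proof. exact: (dwork_ghost p_pr frobE). Qed.

Section GhostComponents.
Variable A : comPzRingType.
Implicit Types x y : W A.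

Lemma ghost_witt0 n : gh (witt0 p_pr A) n = 0.
Proof.
rewrite /ghost big1 // => i _ /=.
by rewrite expr0n expn_eq0 eqn0Ngt prime_gt0 //= mulr0.
Qed.

Lemma ghost_witt1 n : gh (witt1 p_pr A) n = 1.
Proof.
rewrite /ghost big_ord_recl /= expn0 mul1r expr1n big1 ?addr0 // => i _ /=.
by rewrite expr0n expn_eq0 eqn0Ngt prime_gt0 //= mulr0.
Qed.

Lemma ghost_wittD x y n : gh (wittD x y) n = gh x n + gh y n.
Proof.
rewrite /= [wittD_poly]unlock ghost_peval; last exact: dworkD dwork_ghostX dwork_ghostY.
by rewrite rmorphD; congr (_ + _); [apply: peval_ghostX | apply: peval_ghostY].
Qed.

Lemma ghost_wittM x y n : gh (wittM x y) n = gh x n * gh y n.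
Proof.
rewrite /= [wittM_poly]unlock ghost_peval; last exact: dworkM dwork_ghostX dwork_ghostY.
by rewrite rmorphM; congr (_ * _); [apply: peval_ghostX | apply: peval_ghostY].
Qed.

Lemma ghost_wittN x n : gh (wittN x) n = - gh x n.
Proof.
rewrite /= [wittN_poly]unlock ghost_peval; last exact: dworkN dwork_ghostX.
by rewrite rmorphN; congr (- _); apply: peval_ghostX.
Qed.

Lemma ghost_wittF x n : gh (wittF x) n = gh x n.+1.
Proof.
rewrite /= [wittF_poly]unlock ghost_peval; last exact: dwork_shift dwork_ghostX.
by rewrite peval_ghostX.
Qed.

End GhostComponents.

Section Functoriality.
Variables (A B : comPzRingType) (h : {rmorphism A -> B}).
Implicit Types x y : W A.

Fact rmorph_wittXY x y f :
  h (peval (wittXY x y) f) = peval (wittXY (witt_map h x) (witt_map h y)) f.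
Proof. by rewrite rmorph_peval; apply: eq_peval => -[[] n]. Qed.

Lemma witt_map0 : witt_map h (witt0 p_pr A) = witt0 p_pr B.
Proof. by apply: wittP => n /=; rewrite rmorph0. Qed.

Lemma witt_map1 : witt_map h (witt1 p_pr A) = witt1 p_pr B.
Proof. by apply: wittP => n /=; rewrite rmorph_nat. Qed.

Lemma witt_mapD x y :
  witt_map h (wittD x y) = wittD (witt_map h x) (witt_map h y).
Proof. by apply: wittP => n; apply: rmorph_wittXY. Qed.

Lemma witt_mapM x y :
  witt_map h (wittM x y) = wittM (witt_map h x) (witt_map h y).
Proof. by apply: wittP => n; apply: rmorph_wittXY. Qed.

Lemma witt_mapN x : witt_map h (wittN x) = wittN (witt_map h x).
Proof. by apply: wittP => n; apply: rmorph_wittXY. Qed.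

Lemma witt_mapF x : witt_map h (wittF x) = wittF (witt_map h x).
Proof. by apply: wittP => n; apply: rmorph_wittXY. Qed.

Lemma witt_mapV x : witt_map h (wittV x) = wittV (witt_map h x).
Proof. by apply: wittP => -[|n] //=; rewrite rmorph0. Qed.

End Functoriality.

(* Identities between natural operations on Witt vectors may be checked on    *)
(* ghost components.                                                          *)
Lemma witt_natural_eq
    (E F : forall A : comPzRingType, W A -> W A -> W A -> W A) :
  (forall (A B : comPzRingType) (h : {rmorphism A -> B}) x y z,
    witt_map h (E A x y z) = E B (witt_map h x) (witt_map h y) (witt_map h z)) ->
  (forall (A B : comPzRingType) (h : {rmorphism A -> B}) x y z,
    witt_map h (F A x y z) = F B (witt_map h x) (witt_map h y) (witt_map h z)) ->
  (forall (A : comPzRingType) x y z, gh (E A x y z) =1 gh (F A x y z)) ->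
  forall (A : comPzRingType) x y z, E A x y z = F A x y z.
Proof.
move=> natE natF gEF A x y z.
pose v (i : nat * nat) := wcoef (nth z [:: x; y] i.1) i.2.
pose U k : W (intpoly (nat * nat)%type) := Witt p_pr (fun n => ivar (k, n)).
have UE k : witt_map (peval v) (U k) = nth z [:: x; y] k.
  by apply: wittP => n; rewrite /= peval_var.
rewrite -[x](UE 0) -[y](UE 1) -[z](UE 2) -natE -natF; congr witt_map.
apply: wittP; apply: (ghost_inj p_pr (@divpolyK _)); exact: gEF.
Qed.

Let natural := (witt_map0, witt_map1, witt_mapD, witt_mapM, witt_mapN).
Let ghostE := (ghost_witt0, ghost_witt1, ghost_wittD, ghost_wittM, ghost_wittN).

Lemma wittDA (A : comPzRingType) : associative (@wittD p p_pr A).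
Proof.
apply: (witt_natural_eq (E := fun A x y z => wittD x (wittD y z))
  (F := fun A x y z => wittD (wittD x y) z)) => [B C h|B C h|B] x y z.
- by rewrite !natural.
- by rewrite !natural.
- by move=> n; rewrite !ghostE addrA.
Qed.

Lemma wittDC (A : comPzRingType) : commutative (@wittD p p_pr A).
Proof.
move=> x y; apply: (witt_natural_eq (E := fun A x y z => wittD x y)
  (F := fun A x y z => wittD y x) _ _ _ x y x) => [B C h|B C h|B] {x y} x y z.
- by rewrite !natural.
- by rewrite !natural.
- by move=> n; rewrite !ghostE addrC.
Qed.

Lemma witt0D (A : comPzRingType) : left_id (witt0 p_pr A) (@wittD p p_pr A).
Proof.
move=> x; apply: (witt_natural_eq (E := fun A x y z => wittD (witt0 p_pr A) x)
  (F := fun A x y z => x) _ _ _ x x x) => [B C h|B C h|B] {x} x y z //.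
- by rewrite !natural.
- by move=> n; rewrite !ghostE add0r.
Qed.

Lemma wittND (A : comPzRingType) :
  left_inverse (witt0 p_pr A) (@wittN p p_pr A) (@wittD p p_pr A).
Proof.
move=> x; apply: (witt_natural_eq (E := fun A x y z => wittD (wittN x) x)
  (F := fun A x y z => witt0 p_pr A) _ _ _ x x x)
  => [B C h|B C h|B] {x} x y z.
- by rewrite !natural.
- by rewrite !natural.
- by move=> n; rewrite !ghostE addNr.
Qed.

Lemma wittMA (A : comPzRingType) : associative (@wittM p p_pr A).
Proof.
apply: (witt_natural_eq (E := fun A x y z => wittM x (wittM y z))
  (F := fun A x y z => wittM (wittM x y) z)) => [B C h|B C h|B] x y z.
- by rewrite !natural.
- by rewrite !natural.
- by move=> n; rewrite !ghostE mulrA.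
Qed.

Lemma wittMC (A : comPzRingType) : commutative (@wittM p p_pr A).
Proof.
move=> x y; apply: (witt_natural_eq (E := fun A x y z => wittM x y)
  (F := fun A x y z => wittM y x) _ _ _ x y x) => [B C h|B C h|B] {x y} x y z.
- by rewrite !natural.
- by rewrite !natural.
- by move=> n; rewrite !ghostE mulrC.
Qed.

Lemma witt1M (A : comPzRingType) : left_id (witt1 p_pr A) (@wittM p p_pr A).
Proof.
move=> x; apply: (witt_natural_eq (E := fun A x y z => wittM (witt1 p_pr A) x)
  (F := fun A x y z => x) _ _ _ x x x) => [B C h|B C h|B] {x} x y z //.
- by rewrite !natural.
- by move=> n; rewrite !ghostE mul1r.
Qed.

Lemma wittMDl (A : comPzRingType) :
  left_distributive (@wittM p p_pr A) (@wittD p p_pr A).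
Proof.
apply: (witt_natural_eq (E := fun A x y z => wittM (wittD x y) z)
  (F := fun A x y z => wittD (wittM x z) (wittM y z)))
  => [B C h|B C h|B] x y z.
- by rewrite !natural.
- by rewrite !natural.
- by move=> n; rewrite !ghostE mulrDl.
Qed.

End WittTheory.

HB.instance Definition _ p (p_pr : prime p) (A : comPzRingType) :=
  GRing.isZmodule.Build (witt p_pr A) (@wittDA p p_pr A) (@wittDC p p_pr A)
    (@witt0D p p_pr A) (@wittND p p_pr A).
HB.instance Definition _ p (p_pr : prime p) (A : comPzRingType) :=
  GRing.Zmodule_isComPzRing.Build (witt p_pr A) (@wittMA p p_pr A)
    (@wittMC p p_pr A) (@witt1M p p_pr A) (@wittMDl p p_pr A).

(* Quadruples (Phi, Psi, u, v) of two abelian groups and two maps between     *)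
(* them, not yet required to be homomorphisms.                                *)
Record diagram : Type := Diagram {
  Phi : zmodType;
  Psi : zmodType;
  umap : Psi -> Phi;
  vmap : Phi -> Psi
}.

(* B is an object of Perv(C, 0). *)
Definition is_perv (B : diagram) : Prop :=
  [/\ zmod_morphism (@umap B), zmod_morphism (@vmap B)
    & bijective (fun y : Psi B => y - vmap (umap y))].

(* A diagram whose underlying abelian groups are the additive groups of rings *)
(* B0 = Phi and B1 = Psi is a ring object of Perv(C, 0).                      *)
Definition is_ring_object (B0 B1 : pzRingType) (u : B1 -> B0) (v : B0 -> B1) :
    Prop :=
  [/\ is_perv (Diagram u v),
      zmod_morphism u /\ monoid_morphism u
    & forall (y : B1) (x : B0), v (u y * x) = y * v x].

(* Main.v *)
Require Import Defs.
From mathcomp Require Import all_boot all_order all_algebra.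
From mathcomp Require Import finmap monalg.

(** Additivity of V, the fact that F is a ring homomorphism and the projection
    formula V (F y * x) = y * V x are natural identities, which can be read off
    ghost components.  For the invertibility of 1 - V F, note that p = 0 in A
    makes F the coefficientwise p-th power, so that the n-th coefficient of
    z + V (F x) depends on the first n coefficients of x only: the map
    x |-> z + V (F x) is a contraction for the V-adic topology and hence has
    exactly one fixed point, which is the preimage of z under 1 - V F. *)

Set Implicit Arguments.
Unset Strict Implicit.
Unset Printing Implicit Defensive.

Import GRing.Theory.
Local Open Scope ring_scope.

(** * Fixed points of contractions on sequences *)

Section Contraction.
Variables (A : Type) (a : A) (T : (nat -> A) -> nat -> A).
Hypothesis contrT : forall x y n,
  (forall i, (i < n)%N -> x i = y i) -> T x n = T y n.

Lemma contraction_fixpoint_unique x y : T x =1 x -> T y =1 y -> x =1 y.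
Proof.
move=> Tx Ty; elim/ltn_ind => n IHn.
by rewrite -Tx -Ty; apply: contrT.
Qed.

Lemma contraction_fixpoint : exists x, T x =1 x.
Proof.
pose x0 : nat -> A := fun=> a.
(* Coefficient [i] no longer changes from iterate [i.+1] on, so the diagonal of the iterates is
   their limit. *)
have stable n m i : (i < n)%N -> (n <= m)%N -> iter m T x0 i = iter n T x0 i.
  elim: n m i => // n IHn [//|m] i i_n n_m /=.
  apply: contrT => j j_i; apply: IHn => //.
  exact: leq_trans j_i _.
exists (fun n => iter n.+1 T x0 n) => n /=.
by apply: contrT => i i_n; rewrite (stable i.+1 n).
Qed.

End Contraction.

(** * Ghost components over a torsion-free ring *)

Section LocalGhost.
Variables (p : nat) (p_pr : prime p).
Variables (R : comPzRingType) (divR : nat -> R -> R).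
Hypothesis divRK : forall d a, (0 < d)%N -> divR d (d%:R * a) = a.

Let ppos n : (0 < p ^ n)%N.
Proof. by rewrite expn_gt0 prime_gt0. Qed.

Lemma ghost_inj_le (x y : nat -> R) n :
  (forall i, (i <= n)%N -> ghost p x i = ghost p y i) ->
  forall i, (i <= n)%N -> x i = y i.
Proof.
move=> gxy; elim/ltn_ind => i IHi i_n.
have := gxy i i_n; rewrite !ghostS.
under eq_bigr => j _ do
  rewrite (IHi j (ltn_ord j) (leq_trans (ltnW (ltn_ord j)) i_n)).
by move/addrI/(natmulI divRK (ppos i)).
Qed.

(** Here [z] is the Frobenius of [x]. Modulo [p ^ n.+1] the first [n] terms of both ghost sums agree
    by induction; cancelling [p ^ n] in what remains leaves a congruence modulo [p]. *)
Lemma ghost_shift_expr (x z : nat -> R) :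
  (forall n, ghost p z n = ghost p x n.+1) ->
  forall n, eqmodn p (z n) (x n ^+ p).
Proof.
move=> gzx; elim/ltn_ind => n IHn.
have xzn : eqmodn (p ^ n.+1) (ghost p x n.+1)
   (\sum_(i < n) (p ^ i)%:R * z i ^+ (p ^ (n - i)) + (p ^ n)%:R * x n ^+ p).
  rewrite ghostS -[X in eqmodn _ _ X]addr0.
  apply: eqmodnD (eqmodn0 _ _); rewrite big_ord_recr /= subSnn expn1.
  apply: eqmodnD; last exact: eqmodn_refl.
  apply: eqmodn_sum => i _; rewrite subSn ?(ltnW (ltn_ord i)) //.
  (* Raising the congruence of [x i ^+ p] and [z i] to the power [p ^ (n - i)] gains [n - i] factors
     [p]; the coefficient [p ^ i] supplies the others. *)
  rewrite [in X in eqmodn _ X]expnS exprM.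
  have -> : (p ^ n.+1 = p ^ i * p ^ (n - i).+1)%N.
    by rewrite -expnD addnS subnKC // ltnW.
  apply/eqmodn_scale/eqmodn_exprpn => //.
  exact/eqmodn_sym/IHn.
move: xzn; rewrite -gzx ghostS => -[c].
rewrite -addrA => /addrI; rewrite expnSr natrM -mulrA -mulrDr.
by move/(natmulI divRK (ppos n)) => ->; exists c.
Qed.

End LocalGhost.

(** * Frobenius and Verschiebung on Witt vectors *)

Section WittFV.
Variables (p : nat) (p_pr : prime p).

Local Notation W A := (witt p_pr A).
Local Notation gh x := (ghost p (wcoef x)).

Lemma ghost_wittV (A : comPzRingType) (x : W A) n :
  gh (wittV x) n = if n is m.+1 then p%:R * gh x m else 0.
Proof.
rewrite /ghost big_ord_recl /= expr0n expn_eq0 eqn0Ngt prime_gt0 //= mulr0.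
rewrite add0r; case: n => [|n]; first by rewrite big_ord0.
rewrite mulr_sumr; apply: eq_bigr => i _.
by rewrite /= /bump /= add1n expnS natrM mulrA.
Qed.

Let natural := (witt_map0, witt_map1, witt_mapD, witt_mapM, witt_mapN,
  witt_mapF, witt_mapV).
Let ghostE := (ghost_witt0, ghost_witt1, ghost_wittD, ghost_wittM, ghost_wittN,
  ghost_wittF, ghost_wittV).

Lemma wittFB (A : comPzRingType) : zmod_morphism (@wittF p p_pr A).
Proof.
move=> x y; apply: (witt_natural_eq
  (E := fun A x y z => wittF (wittD x (wittN y)))
  (F := fun A x y z => wittD (wittF x) (wittN (wittF y))) _ _ _ x y x)
  => [B C h|B C h|B] {x y} x y z.
- by rewrite !natural.
- by rewrite !natural.
- by move=> n; rewrite !ghostE.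
Qed.

Lemma wittVB (A : comPzRingType) : zmod_morphism (@wittV p p_pr A).
Proof.
move=> x y; apply: (witt_natural_eq
  (E := fun A x y z => wittV (wittD x (wittN y)))
  (F := fun A x y z => wittD (wittV x) (wittN (wittV y))) _ _ _ x y x)
  => [B C h|B C h|B] {x y} x y z.
- by rewrite !natural.
- by rewrite !natural.
- by case=> [|n]; rewrite !ghostE ?subr0 // mulrBr.
Qed.

Lemma wittF1 (A : comPzRingType) : wittF (witt1 p_pr A) = witt1 p_pr A.
Proof.
pose o := witt1 p_pr A; apply: (witt_natural_eq
  (E := fun A x y z => wittF (witt1 p_pr A))
  (F := fun A x y z => witt1 p_pr A) _ _ _ o o o)
  => [B C h|B C h|B] x y z.
- by rewrite !natural.
- by rewrite !natural.
- by move=> n; rewrite !ghostE.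
Qed.

Lemma wittFM (A : comPzRingType) (x y : W A) :
  wittF (wittM x y) = wittM (wittF x) (wittF y).
Proof.
apply: (witt_natural_eq
  (E := fun A x y z => wittF (wittM x y))
  (F := fun A x y z => wittM (wittF x) (wittF y)) _ _ _ x y x)
  => [B C h|B C h|B] {x y} x y z.
- by rewrite !natural.
- by rewrite !natural.
- by move=> n; rewrite !ghostE.
Qed.

(** In ghost component [n.+1] both sides are [p] times [gh y n.+1 * gh x n]; in component 0 both
    vanish. *)
Lemma wittV_projection (A : comPzRingType) (y x : W A) :
  wittV (wittM (wittF y) x) = wittM y (wittV x).
Proof.
apply: (witt_natural_eq
  (E := fun A y x z => wittV (wittM (wittF y) x))
  (F := fun A y x z => wittM y (wittV x)) _ _ _ y x x)
  => [B C h|B C h|B] {x y} y x z.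
- by rewrite !natural.
- by rewrite !natural.
- by case=> [|n]; rewrite !ghostE ?mulr0 // mulrCA.
Qed.

Lemma wcoefD_local_lift (R A : comPzRingType) (divR : nat -> R -> R)
    (divRK : forall d a, (0 < d)%N -> divR d (d%:R * a) = a)
    (h : {rmorphism R -> A}) (z x y : W R) n :
  (forall i, (i <= n)%N -> wcoef x i = wcoef y i) ->
  wcoef (wittD (witt_map h z) (witt_map h x)) n =
  wcoef (wittD (witt_map h z) (witt_map h y)) n.
Proof.
move=> xy; have zxy : wcoef (wittD z x) n = wcoef (wittD z y) n.
  apply: (ghost_inj_le p_pr divRK _ (leqnn n)) => i i_n.
  rewrite !ghost_wittD; congr (_ + _); apply: eq_ghost => j j_i.
  exact: xy (leq_trans j_i i_n).
rewrite -!witt_mapD; exact: (congr1 h zxy).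
Qed.

(* The identity is checked for the universal pair of vectors sharing their
   first n.+1 coefficients, whose ring of coefficients has no torsion. *)
Lemma wcoefD_local (A : comPzRingType) (z x y : W A) n :
  (forall i, (i <= n)%N -> wcoef x i = wcoef y i) ->
  wcoef (wittD z x) n = wcoef (wittD z y) n.
Proof.
move=> xy; pose R : comPzRingType := intpoly (nat * nat)%type.
pose v (i : nat * nat) := wcoef (nth z [:: x; y] i.1) i.2.
pose h : {rmorphism R -> A} := peval v.
pose X k : W R := Witt p_pr (fun i => ivar (k, i)).
(* [Y] takes the variables of [X 0] up to index [n] and those of [X 1] beyond. *)
pose Y : W R := Witt p_pr (fun i => ivar (if (i <= n)%N then 0%N else 1%N, i)).
have XE k : witt_map h (X k) = nth z [:: x; y] k.
  by apply: wittP => i; rewrite /= peval_var.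
have YE : witt_map h Y = y.
  apply: wittP => i; rewrite /= peval_var /v /=.
  by case: ifP => // /xy.
have XY i : (i <= n)%N -> wcoef (X 0%N) i = wcoef Y i.
  by move=> i_n; rewrite /= i_n.
have := wcoefD_local_lift (@divpolyK _) h (X 2%N) XY.
clearbody h X Y; rewrite YE.
have -> : witt_map h (X 0%N) = x := XE 0%N.
have -> : witt_map h (X 2%N) = z := XE 2%N.
exact.
Qed.

(** The congruence modulo [p] holds for the universal vector [X]; specialising to [A] kills the
    multiple of [p]. *)
Lemma wcoefF_pchar (A : comPzRingType) (x : W A) n :
  p%:R = 0 :> A -> wcoef (wittF x) n = wcoef x n ^+ p.
Proof.
move=> p0; pose X : W (intpoly nat) := Witt p_pr (fun i => ivar i).
have XE : witt_map (peval (wcoef x)) X = x.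
  by apply: wittP => i; rewrite /= peval_var.
have [|c cE] := ghost_shift_expr p_pr (@divpolyK _) (z := wcoef (wittF X))
    (x := wcoef X) _ n.
  by move=> m; rewrite ghost_wittF.
have -> : wcoef (wittF x) n = peval (wcoef x) (wcoef (wittF X) n).
  by rewrite -[in LHS]XE -witt_mapF.
rewrite cE rmorphD rmorphM rmorph_nat rmorphXn /= p0 mul0r addr0.
by rewrite peval_var.
Qed.

Lemma bijective_subVF (A : comPzRingType) : p%:R = 0 :> A ->
  bijective (fun x : W A => x - wittV (wittF x)).
Proof.
move=> p0; pose T (z : W A) (x : nat -> A) : nat -> A :=
  wcoef (z + wittV (wittF (Witt p_pr x))).
have contrT z x y n : (forall i, (i < n)%N -> x i = y i) -> T z x n = T z y n.
  (* The shift by V makes the dependence strict: coefficient 0 is constant, and coefficient [i.+1]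
     involves only [x i]. *)
  move=> xy; apply: wcoefD_local => -[//|i] i_n.
  have E (w : nat -> A) : wcoef (wittV (wittF (Witt p_pr w))) i.+1 = w i ^+ p.
    exact: (wcoefF_pchar (Witt p_pr w) i p0).
  by rewrite !E xy.
have fixP z (x : W A) : T z (wcoef x) =1 wcoef x <-> x - wittV (wittF x) = z.
  have TE : T z (wcoef x) = wcoef (z + wittV (wittF x)) by case: x.
  rewrite TE; split=> [/wittP zE | <-]; last by rewrite subrK.
  by rewrite -{1}zE addrK.
(* Choice turns the existence of fixed points into an inverse function. *)
have ex z : {x : W A | x - wittV (wittF x) = z}.
  apply: boolp.cid; have [x xE] := contraction_fixpoint 0 (contrT z).
  by exists (Witt p_pr x); apply/fixP.
exists (fun z => sval (ex z)) => [x|z]; last exact: (svalP (ex z)).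
case: (ex _) => y /= yE; apply: wittP.
by apply: (contraction_fixpoint_unique (contrT (x - wittV (wittF x))));
  apply/fixP.
Qed.

End WittFV.

Theorem mainTheorem1 (p : nat) (p_pr : prime p) (A : comPzRingType)
    (iota : {rmorphism 'F_p -> A}) :
  let W : comPzRingType := witt p_pr A in
  let u : W -> W := @wittF p p_pr A in
  let v : W -> W := @wittV p p_pr A in
  is_perv (Diagram u v) /\ is_ring_object u v.
Proof.
move=> W u v.
have p0 : p%:R = 0 :> A.
  by rewrite -(rmorph_nat iota) (pcharf0 (pchar_Fp p_pr)) rmorph0.
have perv : is_perv (Diagram u v).
  split; [exact: wittFB | exact: wittVB | exact: bijective_subVF].
split=> //; split=> //; last exact: wittV_projection.
split; first exact: wittFB.
by split; [exact: wittF1 | exact: wittFM].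
Qed.
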